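(* Assume the no-arbitrage condition: for every $y\in\mathbb{R}^m$, if $\langle y,g(\omega)\rangle-\pi(y)\ge0$ for all $\omega\in\Omega$, then $\langle y,g(\omega)\rangle-\pi(y)=0$ for all $\omega\in\Omega$. Let $f:\Omega\to\mathbb{R}$ be Borel measurable. Then: (i) $\phi(f)>-\infty$. (ii) There exists $y\in\mathbb{R}^m$ such that $\phi(f)+\langle y,g(\omega)\rangle-\pi(y)\ge f(\omega)$ for all $\omega\in\Omega$. Hence the infimum defining $\phi(f)$ is attained when $\phi(f)<\infty$. (iii) The following superhedging duality holds: $$\phi(f)=\sup_{\mu\in\mathcal{Q}}\int_\Omega f\,\mathrm{d}\mu .$$
   Context: $\Omega$ is a Polish space with its Borel $\sigma$-algebra, and $\mathcal{P}(\Omega)$ is the set of Borel probability measures on $\Omega$. Let $m\in\mathbb{N}$, let $g_1,\dots,g_m:\Omega\to\mathbb{R}$ be Borel measurable, and let $g=(g_1,\dots,g_m)^{\mathsf T}$. Let $\underline{\pi}_j\le\overline{\pi}_j$ be real numbers for $j=1,\dots,m$. For $y\in\mathbb{R}^m$ set $\pi(y):=\sum_{j=1}^m\big(y_j^+\overline{\pi}_j-y_j^-\underline{\pi}_j\big)$ with $y_j^+:=\max\{y_j,0\}$, $y_j^-:=\max\{-y_j,0\}$, and $\langle y,g\rangle:=\sum_{j=1}^m y_jg_j$. Define $$\phi(f):=\inf\big\{c+\pi(y):\ c\in\mathbb{R},\ y\in\mathbb{R}^m,\ c+\langle y,g(\omega)\rangle\ge f(\omega)\ \forall\omega\in\Omega\big\}\in[-\infty,\infty]$$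 (with $\inf\emptyset=+\infty$), and $$\mathcal{Q}:=\Big\{\mu\in\mathcal{P}(\Omega):\ \underline{\pi}_j\le\int_\Omega g_j\,\mathrm{d}\mu\le\overline{\pi}_j\ \text{ for } j=1,\dots,m\Big\},$$ where membership in $\mathcal{Q}$ includes that each $g_j$ is $\mu$-integrable. The integral $\int_\Omega f\,\mathrm{d}\mu$ is understood as $\int f^+\mathrm{d}\mu-\int f^-\mathrm{d}\mu\in[-\infty,\infty]$ with the convention $\infty-\infty:=-\infty$. In (ii), when $\phi(f)=\infty$ the inequality is trivially true. *)

(* Defs.v *)
From mathcomp Require Import all_boot all_order all_algebra.
From mathcomp Require Import all_classical all_reals all_analysis.

Set Implicit Arguments.
Unset Strict Implicit.
Unset Printing Implicit Defensive.

Import Order.TTheory GRing.Theory Num.Theory.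
Import numFieldNormedType.Exports.

Local Open Scope classical_set_scope.
Local Open Scope ring_scope.

Definition separable_space (T : topologicalType) : Prop :=
  exists2 S : set T, countable S & dense S.

Record is_metric (R : realType) (T : Type) (d : T -> T -> R) : Prop := {
  metric_self : forall x, d x x = 0;
  metric_separated : forall x y, d x y = 0 -> x = y;
  metric_symmetric : forall x y, d x y = d y x;
  metric_triangular : forall x y z, d x z <= d x y + d y z
}.

Definition metric_induces_topology (R : realType) (T : topologicalType)
    (d : T -> T -> R) : Prop :=
  forall (x : T) (A : set T),
    nbhs x A <-> exists2 e : R, 0 < e & [set y | d x y < e] `<=` A.

Definition metric_cauchy (R : realType) (T : Type) (d : T -> T -> R)
    (u : nat -> T) : Prop :=
  forall e : R, 0 < e ->
    exists N : nat, forall p q : nat, (N <= p)%N -> (N <= q)%N -> d (u p) (u q) < e.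

Definition completely_metrizable (R : realType) (T : topologicalType) : Prop :=
  exists d : T -> T -> R,
    [/\ is_metric d,
        metric_induces_topology d
      & forall u : nat -> T, metric_cauchy d u ->
          exists l : T, u @ \oo --> l].

Definition polish (R : realType) (T : topologicalType) : Prop :=
  separable_space T /\ completely_metrizable R T.

(* A notation, so that the measurable structure is inferred. The carrier is
   pointed, hence nonempty. *)
Notation borel T := (g_sigma_algebraType (@open T)).

Definition pairing (R : realType) (m : nat) (T : Type)
    (g : 'I_m -> T -> R) (y : 'rV[R]_m) (w : T) : R :=
  \sum_(j < m) y ord0 j * g j w.

(* [lo j] and [hi j] are the bid and ask prices of the payoff [g j]. *)
Definition price (R : realType) (m : nat) (lo hi : 'I_m -> R)
    (y : 'rV[R]_m) : R :=
  \sum_(j < m)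
    (Num.max (y ord0 j) 0 * hi j - Num.max (- y ord0 j) 0 * lo j).

Definition superhedges (R : realType) (m : nat) (T : Type)
    (g : 'I_m -> T -> R) (f : T -> R) (c : R) (y : 'rV[R]_m) : Prop :=
  forall w : T, f w <= c + pairing g y w.

Definition superhedging_price (R : realType) (m : nat) (T : Type)
    (g : 'I_m -> T -> R) (lo hi : 'I_m -> R) (f : T -> R) : \bar R :=
  ereal_inf [set (p.1 + price lo hi p.2)%:E
            | p in [set p : R * 'rV[R]_m | superhedges g f p.1 p.2]].

Definition no_arbitrage (R : realType) (m : nat) (T : Type)
    (g : 'I_m -> T -> R) (lo hi : 'I_m -> R) : Prop :=
  forall y : 'rV[R]_m,
    (forall w : T, 0 <= pairing g y w - price lo hi y) ->
    forall w : T, pairing g y w - price lo hi y = 0.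

Definition calibrated (R : realType) (m : nat) (T : ptopologicalType)
    (g : 'I_m -> T -> R) (lo hi : 'I_m -> R) : set (probability (borel T) R) :=
  [set mu | forall j : 'I_m,
     mu.-integrable [set: borel T] (fun w => (g j w)%:E) /\
     ((lo j)%:E <= \int[mu]_w (g j w)%:E <= (hi j)%:E)%E].

(* Main.v *)
Require Import Defs.
From mathcomp Require Import all_boot all_order all_algebra.
From mathcomp Require Import all_classical all_reals all_analysis.
From mathcomp Require Import measurable_realfun.
From HB Require Import structures.
From mathcomp Require Import ring lra.

(** Consider the 2m instruments g_j - hi_j and lo_j - g_j, each of which may be
    held in any nonnegative amount. Up to free disposal, the gains
    <y, g> - price y of the portfolios y are the elements of the convex cone W
    generated by these instruments. Absence of arbitrage says that a nonnegative
    element of W is zero, and a finitely supported probability measure is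
    calibrated exactly when its expectation is nonpositive on W.

    The core is an exact theorem of the alternative ([pricing_alternative],
    [hedging_alternative]): for each claim f and each real capital c, either
    some finitely supported calibrated measure gives f an expectation strictly
    larger than c, or c is enough to superhedge f. Because it holds at every c,
    including the critical one, it yields at once attainment (take c to be the
    superhedging price: weak duality excludes the first branch) and the absence
    of a duality gap (take c to be the supremum over calibrated measures). It
    also produces a calibrated measure under which all measurable functions are
    integrable, by trying to superhedge the claim 1 from nothing; weak duality
    then bounds the price from below.

    The alternative is proved by induction on the number of generators. Let h
    be the last one and V the cone of the others. Superhedging f with t units
    of h is superhedging f - t h in V, so if no t works then for each t the
    induction hypothesis provides a pricing rule l for V with l f - c > t l h.
    The pairs (l h, l f - c) form a convex set in the plane; either this set
    contains a point (0, b) with b > 0, which is the wanted pricing rule, or it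
    lies below a line of some slope t, which is the wanted position in h
    ([vertical_or_slope]; for a position restricted to be nonnegative,
    [left_vertical_or_slope]).

    This planar alternative needs points of the set on the left of the vertical
    axis, and also on its right if h may be sold short. If there are none, the
    induction hypothesis shows that - h, or h in the second case, belongs to V.
    Say that - h does: then the generators used to replicate - h can be sold
    short as well as bought, and making them free lines renders h redundant
    ([fg_cone_flip]), so that W is generated by one generator less. This is why
    generators carry a flag telling whether they span a ray or a line. *)

Set Implicit Arguments.
Unset Strict Implicit.
Unset Printing Implicit Defensive.

Import Order.TTheory GRing.Theory Num.Theory.
Import numFieldNormedType.Exports.

Local Open Scope classical_set_scope.
Local Open Scope ring_scope.

(** * Convex sets in the plane *)

Section PlaneAlternative.
Context {R : realType}.
Implicit Type D : set (R * R).

Definition mix_closed D := forall a b a' b' p, D (a, b) -> D (a', b') ->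
  0 <= p <= 1 -> D (p * a + (1 - p) * a', p * b + (1 - p) * b').

(** If the half-line is missed, joining a point on the left of the vertical axis
    to one on its right crosses the axis at a height at most 0, so the slopes
    b / a of the right points lie below those of the left points. Any number in
    between, such as the supremum of the right slopes, is the wanted t. *)
Lemma vertical_or_slope D a1 b1 a2 b2 : mix_closed D ->
  D (a1, b1) -> a1 < 0 -> D (a2, b2) -> 0 < a2 ->
  (exists2 b, 0 < b & D (0, b)) \/
  (exists t, forall a b, D (a, b) -> b <= t * a).
Proof.
move=> Dmix D1 a1_lt0 D2 a2_gt0.
have [|noD] := pselect (exists2 b, 0 < b & D (0, b)); [by left|right].
have slope a b a' b' : D (a, b) -> a < 0 -> D (a', b') -> 0 < a' ->
    b' / a' <= b / a.
  move=> Dab a_lt0 Dab' a'_gt0; rewrite ler_pdivrMr// mulrAC ler_ndivlMr//.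
  rewrite leNgt; apply/negP => lt_ba.
  have d_gt0 : 0 < a' - a by lra.
  apply: noD; exists ((a' * b - a * b') / (a' - a)).
    by apply: divr_gt0 => //; nra.
  have p01 : 0 <= a' / (a' - a) <= 1.
    apply/andP; split; first by apply: divr_ge0; lra.
    by rewrite ler_pdivrMr// mul1r; lra.
  have := Dmix _ _ _ _ _ Dab Dab' p01.
  by congr (D (_, _)); field; lra.
pose S := [set s | exists a b, [/\ D (a, b), 0 < a & s = b / a]].
have S_ub a b : D (a, b) -> a < 0 -> ubound S (b / a).
  by move=> Dab a_lt0 _ [a' [b' [Dab' a'_gt0 ->]]]; exact: slope Dab' _.
have S_sup : has_sup S.
  by split; [exists (b2 / a2), a2, b2 | exists (b1 / a1); exact: S_ub].
exists (sup S) => a b Dab; case: (ltgtP a 0) => [a_lt0|a_gt0|a0].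
- rewrite -ler_ndivlMr//; apply: ge_sup; [by case: S_sup | exact: S_ub].
- by rewrite -ler_pdivrMr//; apply: ub_le_sup; [by case: S_sup | exists a, b].
- rewrite a0 mulr0 leNgt; apply/negP => b_gt0; apply: noD; exists b => //.
  by rewrite -a0.
Qed.

(** The version for a position that can only be held in nonnegative amounts.
    Translating the set to the right by arbitrary amounts reduces it to the
    previous one: the line must stay above every translate, which forces its
    slope to be nonnegative. *)
Lemma left_vertical_or_slope D a1 b1 : mix_closed D ->
  D (a1, b1) -> a1 < 0 ->
  (exists a b, [/\ a <= 0, 0 < b & D (a, b)]) \/
  (exists2 t, 0 <= t & forall a b, D (a, b) -> b <= t * a).
Proof.
move=> Dmix D1 a1_lt0.
pose D' := [set q : R * R | exists2 s, 0 <= s & D (q.1 - s, q.2)].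
have D'mix : mix_closed D'.
  move=> a b a' b' p [s /= s0 Ds] [s' /= s'0 Ds'] p01.
  exists (p * s + (1 - p) * s') => /=.
    by move: p01 => /andP[p0 p1]; rewrite addr_ge0// mulr_ge0//; lra.
  by have := Dmix _ _ _ _ _ Ds Ds' p01; congr (D (_, _)); ring.
have DD' a b s : 0 <= s -> D (a, b) -> D' (a + s, b).
  by move=> s0 Dab; exists s => //=; rewrite addrK.
have D'1 : D' (a1, b1) by rewrite -[a1]addr0; exact: DD'.
have D'2 : D' (1, b1).
  by rewrite (_ : 1 = a1 + (1 - a1)); [apply: DD' => //; lra | ring].
have [[b b0 [s s0 /= Ds]]|[t tP]] :=
  vertical_or_slope D'mix D'1 a1_lt0 D'2 ltr01.
  by left; exists (0 - s), b; split => //; lra.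
right; exists t => [|a b Dab]; last first.
  by apply: tP; rewrite -[a]addr0; exact: DD'.
rewrite leNgt; apply/negP => t_lt0.
(* A negative slope t fails on the translate of (a1, b1) at which the line
   takes the value - (`|b1| + 1). *)
have := tP _ _ (DD' _ _ ((`|b1| + 1) / - t + (- a1)) _ D1).
have e : t * (a1 + ((`|b1| + 1) / - t - a1)) = - (`|b1| + 1) by field; lra.
have s0 : 0 <= (`|b1| + 1) / - t - a1.
  by apply: addr_ge0; [apply: divr_ge0; [rewrite addr_ge0|lra] | lra].
move=> /(_ s0); rewrite e.
by have := ler_norm (- b1); rewrite normrN; lra.
Qed.

End PlaneAlternative.

(** * Finitely generated cones of payoffs *)

Ltac pointwise_ring := apply/funext => ?; rewrite !fctE /GRing.scale/=; ring.

Section PayoffCones.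
Context {R : realType} {T : Type}.
Implicit Types (W V : set (T -> R)) (h w v f : T -> R).

(** The flag [free] distinguishes a generator spanning a line from one spanning
    a ray. *)
Definition extend (free : bool) W h : set (T -> R) :=
  [set w | exists (t : R) v, [/\ free || (0 <= t), W v & w = t *: h + v]].

Inductive fg_cone : nat -> set (T -> R) -> Prop :=
| fg_cone0 : fg_cone 0 [set 0]
| fg_coneS n W free h : fg_cone n W -> fg_cone n.+1 (extend free W h).

Definition convex_cone W := [/\ W 0, forall v w, W v -> W w -> W (v + w)
  & forall (t : R) w, 0 <= t -> W w -> W (t *: w)].

Lemma fg_cone_convex n W : fg_cone n W -> convex_cone W.
Proof.
elim=> [|{}n {}W free h _ [W0 WD WZ]].
  split=> // [v w -> ->|t w _ ->]; [exact: addr0 | exact: scaler0].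
split.
- by exists 0, 0; split; [rewrite lexx orbT | | rewrite scale0r addr0].
- move=> _ _ [t [v [t0 Wv ->]]] [s [w [s0 Ww ->]]].
  exists (t + s), (v + w); split; [|exact: WD|by rewrite scalerDl addrACA].
  by case: free t0 s0 => //=; exact: addr_ge0.
- move=> s _ s0 [t [v [t0 Wv ->]]].
  exists (s * t), (s *: v); split; [|exact: WZ|by rewrite scalerDr scalerA].
  by case: free t0 => //=; exact: mulr_ge0.
Qed.

Lemma sub_extend free W h w : W w -> extend free W h w.
Proof. by exists 0, w; split; rewrite ?lexx ?orbT// scale0r add0r. Qed.

Lemma mem_extend free W h : W 0 -> extend free W h h.
Proof. by exists 1, 0; split; rewrite ?ler01 ?orbT// scale1r addr0. Qed.

(** Allowing an attainable payoff to be sold short does not cost a generator: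
    if w is a combination of generators, then adding the opposite ray amounts to
    turning into lines the rays that w really uses. *)
Lemma fg_cone_flip n W w : fg_cone n W -> W w ->
  fg_cone n (extend false W (- w)).
Proof.
move=> Wfg; elim: Wfg w => [_ ->|{}n V free h Vfg IH _ [t [v [t0 Vv ->]]]].
  rewrite (_ : extend _ _ _ = [set 0]); first exact: fg_cone0.
  apply/seteqP; split=> [_ [t [_ [_ -> ->]]]|_ ->].
    by rewrite oppr0 scaler0 addr0.
  by exists 0, 0; rewrite lexx scale0r addr0.
have [V0 VD VZ] := fg_cone_convex Vfg.
have [t_eq0|t_neq0] := eqVneq t 0.
  rewrite t_eq0 scale0r add0r.
  rewrite (_ : extend _ _ _ = extend free (extend false V (- v)) h).
    exact/fg_coneS/IH.
  apply/seteqP; split.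
    move=> _ [s [_ [s0 [r [u [r0 Vu ->]]] ->]]].
    exists r, (s *: - v + u); split=> //; last by rewrite addrCA.
    by exists s, u.
  move=> _ [r [_ [r0 [s [u [s0 Vu ->]]] ->]]].
  exists s, (r *: h + u); split=> //; last by rewrite addrCA.
  by exists r, u.
rewrite (_ : extend _ _ _ = extend true (extend false V (- v)) h).
  exact/fg_coneS/IH.
apply/seteqP; split.
  move=> _ [s [_ [s0 [r [u [r0 Vu ->]]] ->]]].
  exists (r - s * t), (s *: - v + u); split=> //; first by exists s, u.
  by pointwise_ring.
move=> _ [r [_ [_ [s [u [s0 Vu ->]]] ->]]]; rewrite /= in s0.
(* The generator h enters w with a positive weight when it spans a ray, so
   adding q times w makes any coefficient of h nonnegative. *)
have compensate a : exists q, [/\ 0 <= q & free || (0 <= a + q * t)].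
  case: free t0 => /= [_|t_ge0]; first by exists 0; rewrite lexx.
  have t_gt0 : 0 < t by rewrite lt_neqAle eq_sym t_neq0.
  exists (`|a| / t); split; first exact: divr_ge0.
  by rewrite divfK//; have := ler_norm (- a); rewrite normrN; lra.
have [q [q0 qP]] := compensate (r + s * t).
exists (s + q), (((r + s * t) + q * t) *: h + (q *: v + u)); split.
- exact: addr_ge0.
- exists (r + s * t + q * t), (q *: v + u); split=> //.
  by apply: VD => //; exact: VZ.
- by pointwise_ring.
Qed.

Lemma extend_opp free W h : convex_cone W -> W (- h) ->
  extend free W h = extend false W h.
Proof.
case: free => // -[W0 WD WZ] WNh; apply/seteqP; split.
  move=> _ [t [v [_ Wv ->]]].
  have [t0|t0] := leP 0 t; first by exists t, v.
  exists 0, ((- t) *: (- h) + v); split=> //=.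
    by apply: WD => //; apply: WZ => //; lra.
  by pointwise_ring.
by move=> _ [t [v [_ Wv ->]]]; exists t, v.
Qed.

Lemma extend_freeN W h : extend true W h = extend true W (- h).
Proof.
apply/seteqP; split=> _ [t [v [_ Wv ->]]]; exists (- t), v; split=> //.
  by rewrite scaleNr scalerN opprK.
by rewrite scaleNr scalerN.
Qed.

(** * Pricing rules and the theorem of the alternative *)

(** Expectations under finitely supported probability measures, presented as
    convex combinations of evaluations: this makes them defined on all
    functions and gives their properties by induction. *)
Inductive finite_expectation : ((T -> R) -> R) -> Prop :=
| finite_expectation_dirac x : finite_expectation (fun f => f x)
| finite_expectation_mix p l l' : 0 <= p <= 1 ->
    finite_expectation l -> finite_expectation l' ->
    finite_expectation (fun f => p * l f + (1 - p) * l' f).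

Lemma finite_expectationP l : finite_expectation l ->
  forall (a : R) v w, l (a *: v + w) = a * l v + l w.
Proof.
elim=> [//|p {}l l' _ _ IH _ IH' a v w].
by rewrite IH IH'; ring.
Qed.

Lemma finite_expectationB l (a : R) v w : finite_expectation l ->
  l (v - a *: w) = l v - a * l w.
Proof. by move=> El; rewrite addrC -scaleNr finite_expectationP//; ring. Qed.

Lemma finite_expectationN l w : finite_expectation l -> l (- w) = - l w.
Proof.
move=> El; have l0 : l 0 = 0.
  by have := finite_expectationP El 1 0 0; rewrite scale1r addr0; lra.
by rewrite -[- w]addr0 -scaleN1r finite_expectationP// l0; ring.
Qed.

Lemma finite_expectation_cst l c :
  finite_expectation l -> l (fun=> c) = c.
Proof. by elim=> [//|p {}l l' _ _ -> _ ->]; ring. Qed.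

Definition pricing_rule W l :=
  finite_expectation l /\ forall w, W w -> l w <= 0.

Definition arbitrage_free W := forall w, W w -> (forall x, 0 <= w x) -> w = 0.

Lemma pricing_rule_mix W h f c : mix_closed
  [set q : R * R | exists2 l, pricing_rule W l & q = (l h, l f - c)].
Proof.
move=> _ _ _ _ p [l [El Wl] [-> ->]] [l' [El' Wl'] [-> ->]] p01.
exists (fun v => p * l v + (1 - p) * l' v); last by congr pair; ring.
split=> [|w Ww]; first exact: finite_expectation_mix.
have := Wl _ Ww; have := Wl' _ Ww; case/andP: p01 => p0 p1.
by nra.
Qed.

(** In the degenerate cases h is redundant, because - h is attainable without
    it (or h itself is, when h is free). Otherwise pricing rules of V giving h a
    negative price exist (and, when h is free, a positive one too), and the
    planar alternative applies to the prices of h and of the claim in excess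
    of c. *)
Lemma pricing_alternative n W f c : fg_cone n W -> arbitrage_free W ->
  (exists2 l, pricing_rule W l & c < l f) \/
  (exists2 w, W w & forall x, f x <= c + w x).
Proof.
elim: n W f c => [|n IH] W f c Wfg.
  inversion_clear Wfg => _.
  have [fc|] := pselect (forall x, f x <= c).
    by right; exists 0 => // x; rewrite [_ x]/= addr0.
  move=> /existsNP[x /negP]; rewrite -ltNge => cfx; left.
  exists (fun v => v x) => //; split; first exact: finite_expectation_dirac.
  by move=> _ ->.
inversion_clear Wfg as [|? V free h Vfg] => NA.
have Vcone := fg_cone_convex Vfg; have [V0 VD VZ] := Vcone.
have NAV : arbitrage_free V by move=> w Vw; apply: NA; exact: sub_extend.
have degenerate w : V w -> extend free V h = extend false V (- w) ->
    (exists2 l, pricing_rule (extend free V h) l & c < l f) \/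
    (exists2 w, extend free V h w & forall x, f x <= c + w x).
  by move=> Vw eqW; apply: IH => //; rewrite eqW; exact: fg_cone_flip.
have [VNh|VNh] := pselect (V (- h)).
  by apply: (degenerate (- h)) => //; rewrite opprK; exact: extend_opp.
have [[free_h Vh]|Vh] := pselect (free /\ V h).
  apply: (degenerate h) => //; rewrite free_h extend_freeN.
  by apply: extend_opp; rewrite ?opprK.
(* If no rule prices u negatively then - u is superhedged from nothing in V,
   and by absence of arbitrage the hedge is exact. *)
have priced_below u : extend free V h u -> ~ V (- u) ->
    exists2 l, pricing_rule V l & l u < 0.
  move=> Wu VNu; have [[l El]|[w Vw uw]] := IH V (- u) 0 Vfg NAV.
    by exists l => //; rewrite -oppr_gt0 -finite_expectationN//; case: El.
  have [W0 WD WZ] := fg_cone_convex (fg_coneS free h Vfg).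
  exfalso; apply: VNu; suff /eqP : u + w = 0.
    by rewrite addrC addr_eq0 => /eqP <-.
  apply: NA => [|x]; first by apply: WD => //; exact: sub_extend.
  by have := uw x; rewrite !fctE; lra.
have [l1 El1 l1h] : exists2 l, pricing_rule V l & l h < 0.
  by apply: priced_below => //; exact: mem_extend.
pose D := [set q : R * R | exists2 l, pricing_rule V l & q = (l h, l f - c)].
have Dmix : mix_closed D by exact: pricing_rule_mix.
have D1 : D (l1 h, l1 f - c) by exists l1.
have hedged t : free || (0 <= t) -> (forall a b, D (a, b) -> b <= t * a) ->
    exists2 w, extend free V h w & forall x, f x <= c + w x.
  move=> t0 tP; have [[l El]|[w Vw fw]] := IH V (f - t *: h) c Vfg NAV.
    have Dl : D (l h, l f - c) by exists l.
    by rewrite finite_expectationB; [have := tP _ _ Dl; lra | case: El].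
  exists (t *: h + w); first by exists t, w.
  by move=> x; have := fw x; rewrite !fctE /GRing.scale/=; lra.
have priced l : pricing_rule V l -> l h <= 0 -> (free -> l h = 0) ->
    c < l f -> exists2 l, pricing_rule (extend free V h) l & c < l f.
  move=> [El Vl] lh0 lh_free clf; exists l => //.
  split=> // _ [t [v [t0 Vv ->]]].
  rewrite finite_expectationP//; have := Vl _ Vv.
  by case: (free) t0 lh_free => [_ -> //|/= t0 _]; [lra|nra].
have [free_h|nfree_h] := pselect free.
  have [l2 El2 l2h] : exists2 l, pricing_rule V l & l (- h) < 0.
    apply: priced_below; last by rewrite opprK => ?; apply: Vh.
    by rewrite free_h extend_freeN; exact: mem_extend.
  have D2 : D (l2 h, l2 f - c) by exists l2.
  have l2h_gt0 : 0 < l2 h 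
    by rewrite finite_expectationN ?oppr_lt0// in l2h; case: El2.
  have [[b b0 [l El [lh bl]]]|[t tP]] :=
    vertical_or_slope Dmix D1 l1h D2 l2h_gt0.
    by left; apply: (priced l) => //; rewrite -?lh//; lra.
  by right; apply: hedged tP; rewrite free_h.
have [[a [b [a0 b0 [l El [lh bl]]]]]|[t t0 tP]] :=
  left_vertical_or_slope Dmix D1 l1h.
  by left; apply: (priced l) => //; [rewrite -lh|lra].
by right; apply: hedged tP; rewrite t0 orbT.
Qed.

End PayoffCones.

(** * Finitely supported measures and integrals *)

Section FiniteExpectationMeasure.
Context {R : realType} {d : measure_display} {T : measurableType d}.
Implicit Types (l : (T -> R) -> R) (mu : probability T R).

Lemma mixture_probability (p q : {nonneg R}) (mu nu : probability T R) :
  p%:num + q%:num = 1 ->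
  exists eta : probability T R, forall v : T -> R, measurable_fun setT v ->
    (forall x, 0 <= v x) ->
    (\int[eta]_x (v x)%:E =
     p%:num%:E * \int[mu]_x (v x)%:E + q%:num%:E * \int[nu]_x (v x)%:E)%E.
Proof.
move=> pq1.
pose eta0 : {measure set T -> \bar R} :=
  measure_add (mscale p mu) (mscale q nu).
have eta01 : eta0 setT = 1%E.
  by rewrite [LHS]measure_addE /= /mscale/= !probability_setT !mule1 -EFinD pq1.
pose etaP := Measure_isProbability.Build _ _ _ eta0 eta01.
pose eta : probability T R := HB.pack (Measure.sort eta0) etaP.
exists eta => v mv v0.
have mvE : measurable_fun setT (EFin \o v) by exact/measurable_EFinP.
have vE0 x : setT x -> (0 <= (v x)%:E)%E by rewrite lee_fin.
by rewrite [LHS]ge0_integral_measure_add// !ge0_integral_mscale.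
Qed.

(** Nonnegative functions come first: there the integral is linear in the
    measure without integrability conditions. *)
Lemma finite_expectation_nonneg l : finite_expectation l ->
  exists mu : probability T R, forall v : T -> R, measurable_fun setT v ->
    (forall x, 0 <= v x) -> (\int[mu]_x (v x)%:E = (l v)%:E)%E.
Proof.
elim=> [a|p {}l l' /andP[p0 p1] _ [mu muP] _ [nu nuP]].
  exists \d_a => v mv v0.
  rewrite integral_dirac//; last exact/measurable_EFinP.
  by rewrite diracT mul1e.
have q0 : 0 <= 1 - p by rewrite subr_ge0.
have [|eta etaP] := @mixture_probability (NngNum p0) (NngNum q0) mu nu.
  by rewrite /= subrKC.
exists eta => v mv v0.
by rewrite etaP//= muP// nuP// -!EFinM -EFinD.
Qed.

Lemma finite_expectation_integral l : finite_expectation l ->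
  exists mu : probability T R, forall v : T -> R, measurable_fun setT v ->
    mu.-integrable setT (EFin \o v) /\ (\int[mu]_x (v x)%:E = (l v)%:E)%E.
Proof.
move=> El; have [mu muP] := finite_expectation_nonneg El.
exists mu => v mv.
have mvp : measurable_fun setT v^\+ by exact: measurable_funrpos.
have mvn : measurable_fun setT v^\- by exact: measurable_funrneg.
split.
  apply/integrableP; split; first exact/measurable_EFinP.
  have mnv : measurable_fun setT (Num.norm \o v) by exact: measurableT_comp.
  by have /= -> := muP _ mnv (fun x => normr_ge0 (v x)); rewrite ltry.
rewrite integralE [X in (X^\+)%E](_ : _ = EFin \o v)// funerpos.
rewrite [X in (X^\-)%E](_ : _ = EFin \o v)// funerneg.
rewrite (muP _ mvp (funrpos_ge0 v)) (muP _ mvn (funrneg_ge0 v)) -EFinB.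
have := finite_expectationB 1 v^\+ v^\- El.
by rewrite scale1r funrposBneg mul1r => ->.
Qed.

End FiniteExpectationMeasure.

Section IntegralMonotone.
Context {R : realType} {d : measure_display} {T : measurableType d}.

(** Comparison of integrals where only the larger function is integrable: the
    smaller one may have integral -oo. *)
Lemma integral_le_integrable (mu : {measure set T -> \bar R})
    (f F : T -> \bar R) :
  measurable_fun setT f -> mu.-integrable setT F ->
  (forall x, f x <= F x)%E -> (\int[mu]_x f x <= \int[mu]_x F x)%E.
Proof.
move=> mf iF fF; have mF := measurable_int _ iF.
rewrite integralE [leRHS]integralE leeB//; apply: ge0_le_integral => //.
- exact: measurable_funepos.
- exact: measurable_funepos.
- by move=> x /mem_set; apply: funepos_le => y _.
- exact: measurable_funeneg.
- exact: measurable_funeneg.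
- by move=> x /mem_set; apply: funeneg_le => y _.
Qed.

End IntegralMonotone.

(** * Prices and gains of portfolios *)

Section Prices.
Context {R : realType} {T : Type} {m : nat}.
Context (g : 'I_m -> T -> R) (lo hi : 'I_m -> R).
Context (lo_le_hi : forall j, lo j <= hi j).
Implicit Types y z : 'rV[R]_m.

(** Holding u units costs the largest value of u * a over the bid-ask
    interval of prices a; sublinearity of [price] and weak duality both follow
    from this. *)
Lemma position_cost_max j (u : R) :
  Num.max u 0 * hi j - Num.max (- u) 0 * lo j = Num.max (u * hi j) (u * lo j).
Proof.
have lh := lo_le_hi j; have [u0|u0] := leP 0 u.
  have -> : Num.max (- u) 0 = 0 by case: leP; lra.
  by have := ler_wpM2l u0 lh; case: leP; lra.
have -> : Num.max (- u) 0 = - u by case: leP; lra.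
by have := ler_wnM2l (ltW u0) lh; case: leP; lra.
Qed.

Lemma position_cost_ge j (u a : R) : lo j <= a <= hi j ->
  u * a <= Num.max u 0 * hi j - Num.max (- u) 0 * lo j.
Proof.
rewrite position_cost_max le_max => /andP[la ah]; apply/orP.
have [u0|u0] := leP 0 u; [left|right]; first exact: ler_wpM2l.
by rewrite ler_wnM2l// ltW.
Qed.

Lemma priceD y z : price lo hi (y + z) <= price lo hi y + price lo hi z.
Proof.
rewrite /price -big_split; apply: ler_sum => j _; rewrite mxE.
rewrite !position_cost_max !mulrDl ge_max.
by apply/andP; split; apply: lerD; rewrite le_max lexx ?orbT.
Qed.

Lemma priceZ t y : 0 <= t -> price lo hi (t *: y) = t * price lo hi y.
Proof.
move=> t0; rewrite /price mulr_sumr; apply: eq_bigr => j _; rewrite mxE.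
by rewrite !position_cost_max maxr_pMr// !mulrA.
Qed.

Lemma price0 : price lo hi 0 = 0.
Proof. by have := priceZ 0 (lexx 0); rewrite scale0r mul0r. Qed.

Lemma price_delta_hi j : price lo hi (delta_mx 0 j) = hi j.
Proof.
rewrite /price (bigD1 j)//= big1 => [|i ij]; rewrite mxE ?eqxx/=.
  by rewrite position_cost_max !mul1r max_l ?addr0.
by rewrite (negbTE ij) !oppr0 maxxx !mul0r subr0.
Qed.

Lemma price_delta_lo j : price lo hi (- delta_mx 0 j) = - lo j.
Proof.
rewrite /price (bigD1 j)//= big1 => [|i ij]; rewrite !mxE ?eqxx/=.
  by rewrite position_cost_max !mulN1r max_r ?lerN2// addr0.
by rewrite (negbTE ij) !oppr0 maxxx !mul0r subr0.
Qed.

Lemma pairingP a y z x :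
  pairing g (a *: y + z) x = a * pairing g y x + pairing g z x.
Proof.
rewrite /pairing mulr_sumr -big_split; apply: eq_bigr => j _.
by rewrite !mxE mulrDl mulrA.
Qed.

Lemma pairing0 x : pairing g 0 x = 0.
Proof. by rewrite /pairing big1 // => j _; rewrite mxE mul0r. Qed.

Lemma pairingZ a y x : pairing g (a *: y) x = a * pairing g y x.
Proof. by rewrite -[a *: y]addr0 pairingP pairing0 addr0. Qed.

Lemma pairing_delta j x : pairing g (delta_mx 0 j) x = g j x.
Proof.
rewrite /pairing (bigD1 j)//= big1 => [|i ij]; rewrite mxE ?eqxx/=.
  by rewrite mul1r addr0.
by rewrite (negbTE ij) mul0r.
Qed.

End Prices.

Section WeakDuality.
Context {R : realType} {d : measure_display} {T : measurableType d} {m : nat}.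
Context (g : 'I_m -> T -> R) (lo hi : 'I_m -> R).
Context (lo_le_hi : forall j, lo j <= hi j).

Lemma integral_le_superhedging_cost (mu : probability T R) (f : T -> R) c y :
  (forall j, mu.-integrable setT (fun x => (g j x)%:E) /\
     ((lo j)%:E <= \int[mu]_x (g j x)%:E <= (hi j)%:E)%E) ->
  measurable_fun setT f -> superhedges g f c y ->
  (\int[mu]_x (f x)%:E <= (c + price lo hi y)%:E)%E.
Proof.
move=> mug mf fcy.
have ic : mu.-integrable setT (cst c%:E).
  exact: finite_measure_integrable_cst.
have ig j : mu.-integrable setT (fun x => (y ord0 j)%:E * (g j x)%:E)%E.
  by apply: integrableZl => //; case: (mug j).
have isum : mu.-integrable setT
    (fun x => \sum_(j < m) (y ord0 j)%:E * (g j x)%:E)%E.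
  exact: integrable_sum.
pose F x := (cst c%:E x + \sum_(j < m) (y ord0 j)%:E * (g j x)%:E)%E.
have iF : mu.-integrable setT F by exact: integrableD.
apply: (@le_trans _ _ (\int[mu]_x F x)%E).
  apply: integral_le_integrable => //; first exact/measurable_EFinP.
  move=> x; rewrite /F /=; under eq_bigr do rewrite -EFinM.
  by rewrite sumEFin -EFinD lee_fin; exact: fcy.
rewrite integralD// integral_cst//.
rewrite [X in (_ * X)%E](@probability_setT _ _ _ mu) mule1 integral_sum//.
rewrite EFinD leeD// -sumEFin; apply: lee_sum => j _.
case: (mug j) => igj; rewrite integralZl//.
rewrite -[(\int[mu]_x _)%E]fineK ?integrable_fin_num// !lee_fin.
exact: position_cost_ge.
Qed.

End WeakDuality.

Section GeneratedCone.
Context {R : realType} {T : Type}.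

Lemma fg_cone_generated (I : eqType) (h : I -> T -> R) (s : seq I)
    (H : set (T -> R)) : convex_cone H -> (forall i, H (h i)) ->
  exists n W, [/\ fg_cone n W, W `<=` H & {in s, forall i, W (h i)}].
Proof.
move=> [H0 HD HZ] Hh; elim: s => [|i s [n [W [Wfg WH Ws]]]].
  by exists 0%N, [set 0]; split; [exact: fg_cone0 | move=> _ -> |].
have [W0 _ _] := fg_cone_convex Wfg.
exists n.+1, (extend false W (h i)); split; first exact: fg_coneS.
  by move=> _ [t [v [/= t0 /WH Hv ->]]]; apply: HD => //; exact: HZ.
move=> k; rewrite in_cons => /predU1P[->|/Ws]; first exact: mem_extend.
exact: sub_extend.
Qed.

End GeneratedCone.

Section Market.
Context {R : realType} {T : Type} {m : nat}.
Context (g : 'I_m -> T -> R) (lo hi : 'I_m -> R).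
Context (lo_le_hi : forall j, lo j <= hi j).

(** Free disposal is what makes this set convex, since the price is only
    sublinear in the portfolio. *)
Definition dominated_gains : set (T -> R) :=
  [set w | exists y, forall x, w x <= pairing g y x - price lo hi y].

Lemma dominated_gains_cone : convex_cone dominated_gains.
Proof.
split.
- by exists 0 => x; rewrite pairing0 price0// subrr.
- move=> v w [y vy] [z wz]; exists (y + z) => x.
  have := priceD lo_le_hi y z; have := vy x; have := wz x.
  by have := pairingP g 1 y z x; rewrite scale1r fctE; lra.
- move=> t w t0 [y wy]; exists (t *: y) => x.
  by rewrite priceZ// pairingZ -mulrBr; exact: ler_wpM2l.
Qed.

Definition instrument (i : bool * 'I_m) : T -> R :=
  if i.1 then fun x => g i.2 x - hi i.2 else fun x => lo i.2 - g i.2 x.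

Lemma instrument_dominated i : dominated_gains (instrument i).
Proof.
case: i => -[] j /=.
  by exists (delta_mx 0 j) => x; rewrite pairing_delta price_delta_hi.
exists (- delta_mx 0 j) => x; rewrite price_delta_lo// opprK addrC.
rewrite /instrument/= -[- delta_mx 0 j]scaleN1r pairingZ pairing_delta.
by rewrite mulN1r.
Qed.

Lemma dominated_gains_arbitrage_free :
  no_arbitrage g lo hi -> arbitrage_free dominated_gains.
Proof.
move=> NA w [y wy] w0; apply/funext => x; apply/eqP.
rewrite eq_le w0 andbT (le_trans (wy x))// NA// => z.
exact: le_trans (w0 z) (wy z).
Qed.

(** The alternative for the cone generated by the 2m instruments: nonpositive
    expectation of g_j - hi_j and of lo_j - g_j is the calibration of g_j. *)
Lemma hedging_alternative (f : T -> R) c : no_arbitrage g lo hi ->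
  (exists l, [/\ finite_expectation l, forall j, lo j <= l (g j) <= hi j
     & c < l f]) \/
  (exists y, forall x, f x <= c + (pairing g y x - price lo hi y)).
Proof.
move=> NA; have [n [W [Wfg WH Wi]]] := fg_cone_generated
  (enum {: bool * 'I_m}) dominated_gains_cone instrument_dominated.
have NAW : arbitrage_free W.
  by move=> w /WH; exact: dominated_gains_arbitrage_free.
have [[l [El Wl] cl]|[w /WH[y wy] fw]] := pricing_alternative f c Wfg NAW.
  left; exists l; split=> // j.
  have lE t (w : T -> R) a : l (t *: w + fun=> a) = t * l w + a.
    by rewrite finite_expectationP// finite_expectation_cst.
  apply/andP; split.
    have := Wl _ (Wi (false, j) (mem_enum _ _)).
    rewrite (_ : instrument _ = -1 *: g j + fun=> lo j) ?lE; first lra.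
    by apply/funext => x; rewrite /instrument !fctE /GRing.scale/=; ring.
  have := Wl _ (Wi (true, j) (mem_enum _ _)).
  rewrite (_ : instrument _ = 1 *: g j + fun=> - hi j) ?lE; first lra.
  by apply/funext => x; rewrite /instrument !fctE /GRing.scale/=; ring.
by right; exists y => x; rewrite (le_trans (fw x))// lerD2l.
Qed.

End Market.

(** * Superhedging duality *)

Lemma calibrated_of_expectation (R : realType) (Omega : ptopologicalType)
    (m : nat) (g : 'I_m -> Omega -> R) (lo hi : 'I_m -> R)
    (l : (Omega -> R) -> R) :
  (forall j, measurable_fun [set: borel Omega] (g j)) ->
  finite_expectation l -> (forall j, lo j <= l (g j) <= hi j) ->
  exists2 mu, calibrated g lo hi mu & forall f : Omega -> R,
    measurable_fun [set: borel Omega] f ->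
    (\int[mu]_w (f w)%:E = (l f)%:E)%E.
Proof.
move=> g_meas El lg.
have [mu muP] := @finite_expectation_integral R _ (borel Omega) _ El.
exists mu => [j|f mf]; last by case: (muP f mf).
by have [ig ->] := muP _ (g_meas j); rewrite !lee_fin; split.
Qed.

Theorem theorem2p2 (R : realType) (Omega : ptopologicalType)
    (Omega_polish : polish R Omega)
    (m : nat) (g : 'I_m -> Omega -> R)
    (g_meas : forall j : 'I_m, measurable_fun [set: borel Omega] (g j))
    (lo hi : 'I_m -> R) (lo_le_hi : forall j : 'I_m, lo j <= hi j)
    (NA : no_arbitrage g lo hi)
    (f : Omega -> R) (f_meas : measurable_fun [set: borel Omega] f) :
  [/\ (-oo < superhedging_price g lo hi f)%E,
      (exists y : 'rV[R]_m, forall w : Omega,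
         ((f w)%:E <= superhedging_price g lo hi f
                      + (pairing g y w)%:E - (price lo hi y)%:E)%E),
      ((superhedging_price g lo hi f < +oo)%E ->
         exists (c : R) (y : 'rV[R]_m), superhedges g f c y /\
           superhedging_price g lo hi f = (c + price lo hi y)%:E)
    & superhedging_price g lo hi f =
      ereal_sup [set \int[mu]_w (f w)%:E | mu in calibrated g lo hi]%E].
Proof.
set phi := superhedging_price g lo hi f.
have phi_le c y : superhedges g f c y -> (phi <= (c + price lo hi y)%:E)%E.
  by move=> fcy; apply: ereal_inf_lbound; exists (c, y).
have weak mu : calibrated g lo hi mu -> (\int[mu]_w (f w)%:E <= phi)%E.
  move=> mug; apply: le_ereal_inf_tmp => _ [[c y] fcy <-].
  exact: integral_le_superhedging_cost.
have strong c : (exists2 mu, calibrated g lo hi mu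
      & (c%:E < \int[mu]_w (f w)%:E)%E) \/
    (exists y, superhedges g f (c - price lo hi y) y).
  have [[l [El lg cl]]|[y fy]] := hedging_alternative lo_le_hi f c NA.
    have [mu mug muE] := calibrated_of_expectation g_meas El lg.
    by left; exists mu => //; rewrite muE// lte_fin.
  by right; exists y => w; have := fy w; lra.
(* Superhedging the claim 1 from zero capital would be an arbitrage. *)
have [mu0 mu0g mu0_gtNy] : exists2 mu, calibrated g lo hi mu
    & (-oo < \int[mu]_w (f w)%:E)%E.
  have [[l [El lg _]]|[y y1]] := hedging_alternative lo_le_hi (fun=> 1) 0 NA.
    have [mu mug muE] := calibrated_of_expectation g_meas El lg.
    by exists mu => //; rewrite muE// ltNyr.
  have := NA y; have := y1 point; rewrite add0r => + NAy.
  by rewrite NAy ?ler10// => w; have := y1 w; lra.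
have phi_gtNy : (-oo < phi)%E by exact: lt_le_trans (weak _ mu0g).
have attained : (phi < +oo)%E ->
    exists2 y, superhedges g f (fine phi - price lo hi y) y
      & phi = (fine phi)%:E.
  move=> phi_lty; have phiE : phi = (fine phi)%:E.
    by rewrite fineK// fin_real// phi_gtNy.
  have [[mu mug]|[y fy]] := strong (fine phi); last by exists y.
  by rewrite -phiE ltNge weak.
split=> //.
- have [/attained[y fy phiE]|] := boolP (phi < +oo)%E.
    exists y => w; rewrite phiE -EFinN -!EFinD lee_fin.
    by have := fy w; lra.
  by rewrite -leNgt leye_eq => /eqP ->; exists 0 => w; rewrite leey.
- move=> /attained[y fy phiE]; exists (fine phi - price lo hi y), y.
  by split=> //; rewrite subrK.
- apply/eqP; rewrite eq_le; apply/andP; split; last first.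
    by apply: ge_ereal_sup => _ [mu mug <-]; exact: weak.
  set sup := ereal_sup _; rewrite leNgt; apply/negP => sup_lt.
  have le_sup mu : calibrated g lo hi mu -> (\int[mu]_w (f w)%:E <= sup)%E.
    by move=> mug; apply: ereal_sup_ubound; exists mu.
  have supE : sup = (fine sup)%:E.
    rewrite fineK// fin_real// (lt_le_trans mu0_gtNy) ?le_sup//=.
    exact: lt_le_trans sup_lt (leey _).
  have [[mu mug]|[y /phi_le]] := strong (fine sup); rewrite -?supE.
    by rewrite ltNge le_sup.
  by rewrite subrK -supE leNgt sup_lt.
Qed.
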